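(* There is a function $\varepsilon : \mathbb{N} \to \mathbb{R}$ with $\varepsilon(n) \to 0$ as $n \to \infty$ such that every planar graph on $n$ vertices is $(3,b)$-colorable for every integer $b \geq 6\sqrt{3}(1+\varepsilon(n))\sqrt{n}$. In other words, $\mathrm{ex}_3(\mathcal{P})(n) \leq 6\sqrt{3}(1+o(1))\sqrt{n}$, where $\mathcal{P}$ is the class of planar graphs.
   Context: A set of vertices $X$ is $2$-independent if any two distinct vertices of $X$ are at distance at least $3$. A graph $G$ is $(a,b)$-colorable if $V(G)$ can be partitioned into $a$ independent sets and $b$ $2$-independent sets (some parts may be empty). For a class $\mathcal{C}$ of graphs, $\mathrm{ex}_a(\mathcal{C})(n)$ denotes the smallest integer $c$ such that every graph of order $n$ in $\mathcal{C}$ is $(a,c)$-colorable. *)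

(* Defs.v *)
From mathcomp Require Import all_boot.
From Stdlib Require Import Reals.
Set Implicit Arguments. Unset Strict Implicit. Unset Printing Implicit Defensive.

Definition simple_graph (T : finType) (e : rel T) : Prop :=
  symmetric e /\ irreflexive e.

Definition independent (T : finType) (e : rel T) (X : pred T) : Prop :=
  forall x y, X x -> X y -> ~~ e x y.

(* X is 2-independent: two distinct vertices are at distance >= 3, i.e. they are
   neither adjacent nor have a common neighbour. *)
Definition two_independent (T : finType) (e : rel T) (X : pred T) : Prop :=
  forall x y, X x -> X y -> x <> y ->
    ~~ e x y /\ (forall z, ~~ (e x z && e z y)).

Definition ab_colorable (T : finType) (e : rel T) (a b : nat) : Prop :=
  exists c : T -> 'I_(a + b),
    (forall i : 'I_(a + b), (i < a)%N -> independent e (fun x => c x == i)) /\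
    (forall i : 'I_(a + b), (a <= i)%N -> two_independent e (fun x => c x == i)).

(* Planarity: a drawing in R^2.  Vertices go to distinct points; each edge xy is
   drawn as a simple arc (continuous, injective on [0,1]) from pos x to pos y whose
   interior avoids all vertex points; interiors of arcs of distinct edges are disjoint.
   arc x y and arc y x both describe the edge {x,y} (no constraint between them). *)
Local Open Scope R_scope.
Definition planar (T : finType) (e : rel T) : Prop :=
  exists (pos : T -> R * R) (arc : T -> T -> R -> R * R),
    injective pos /\
    (forall x y, e x y ->
       (forall t, continuity_pt (fun s => fst (arc x y s)) t) /\
       (forall t, continuity_pt (fun s => snd (arc x y s)) t) /\
       arc x y 0 = pos x /\ arc x y 1 = pos y /\
       (forall s t, 0 <= s <= 1 -> 0 <= t <= 1 -> arc x y s = arc x y t -> s = t) /\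
       (forall t z, 0 < t < 1 -> arc x y t <> pos z)) /\
    (forall x y u v, e x y -> e u v ->
       ~ ((x = u /\ y = v) \/ (x = v /\ y = u)) ->
       forall s t, 0 < s < 1 -> 0 < t < 1 -> arc x y s <> arc u v t).

(* Main.v *)
Require Import Defs.
From mathcomp Require Import all_boot.
From mathcomp Require Import zify.
From Stdlib Require Import Reals Lra Ring ClassicalEpsilon.
From Coquelicot Require Import Compactness.
Set Implicit Arguments. Unset Strict Implicit. Unset Printing Implicit Defensive.
Local Open Scope nat_scope.

(** Only the absence of K5 minors is used. It follows from the drawing by a van Kampen style parity
    count: along finely sampled walks, one counts modulo 2 how often the vector to a fixed point
    crosses the positive horizontal half-axis; for two far apart walks the four counts between one
    walk and the ends of the other are related, and the 15 relations for K5 are incompatible.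

    Given d, choose greedily at most n/d hubs such that every vertex has fewer than d neighbours
    among the vertices X that are neither hubs nor adjacent to one. Join the hubs, through at most
    two further vertices per junction, into connected clusters with at most 3n/d vertices in total,
    each of which gets a colour of its own. The remaining vertices outside X split into sets
    dominated by a single cluster, with no edges in between; contracting the cluster shows that
    such a set has no K4 minor, so it is 3-colourable. On X, conflicts (distance at most 2) form a
    (8d + O(1))-degenerate graph because all minors have average degree at most 8 (Mader). Now take
    d about (3/5) sqrt n. *)

(** * Minors *)

Section Minors.
Variable T : finType.
Implicit Types (e : rel T) (S A B : {set T}) (f : T -> T).

Definition within e A : rel T := [rel x y | [&& x \in A, y \in A & e x y]].

Definition joined e A : Prop :=
  forall x y, x \in A -> y \in A -> connect (within e A) x y.

Lemma connect_within e A B x y :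
  A \subset B -> connect (within e A) x y -> connect (within e B) x y.
Proof.
move=> /subsetP sAB; apply: connect_sub => x' y' /and3P[xA yA exy].
by apply: connect1; rewrite /within /= !sAB.
Qed.

Lemma joined1 e x : joined e [set x].
Proof. by move=> y z /set1P-> /set1P->; apply: connect0. Qed.

Lemma joinedU e A B a b : symmetric e -> joined e A -> joined e B ->
  a \in A -> b \in B -> e a b -> joined e (A :|: B).
Proof.
move=> se jA jB aA bB eab.
have sA : A \subset A :|: B by apply: subsetUl.
have sB : B \subset A :|: B by apply: subsetUr.
have cab : connect (within e (A :|: B)) a b.
  by apply: connect1; rewrite /within /= !inE aA bB orbT.
have cba : connect (within e (A :|: B)) b a.
  by apply: connect1; rewrite /within /= !inE aA bB orbT se.
move=> x y /setUP[xA|xB] /setUP[yA|yB].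
- exact: connect_within sA (jA _ _ xA yA).
- apply: connect_trans (connect_within sA (jA _ _ xA aA)) _.
  exact: connect_trans cab (connect_within sB (jB _ _ bB yB)).
- apply: connect_trans (connect_within sB (jB _ _ xB bB)) _.
  exact: connect_trans cba (connect_within sA (jA _ _ aA yA)).
- exact: connect_within sB (jB _ _ xB yB).
Qed.

(** Branch sets are indexed by [nat] and constrained only below [t], so adding one more set means
    changing the value at a single index. *)
Definition Kminor t e S : Prop := exists B : nat -> {set T},
  (forall i, i < t -> [/\ B i \subset S, B i != set0 & joined e (B i)]) /\
  (forall i j, i < j -> j < t ->
     [disjoint B i & B j] /\ exists x y, [/\ x \in B i, y \in B j & e x y]).

Lemma Kminor_sub t e S S' : S \subset S' -> Kminor t e S -> Kminor t e S'.
Proof.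
move=> sS [B [h1 h2]]; exists B; split=> // i it.
by have [hs h0 hj] := h1 i it; split=> //; apply: subset_trans hs sS.
Qed.

Lemma Kminor_apex t e S A : symmetric e -> joined e A -> A != set0 ->
  [disjoint S & A] -> (forall x, x \in S -> exists2 a, a \in A & e x a) ->
  Kminor t e S -> Kminor t.+1 e (S :|: A).
Proof.
move=> se jA A0 dSA hA [B [h1 h2]].
exists (fun i => if i == t then A else B i); split=> [i|i j].
  case: eqP => [_ _|ne lt]; first by split=> //; apply: subsetUr.
  have [] := h1 i; first by lia.
  by move=> sB B0 jB; split=> //; apply: subset_trans sB (subsetUl _ _).
case: (i =P t) => [->|ni]; first by lia.
case: (j =P t) => [->|nj] ij jt; last by apply: h2 => //; lia.
have [sB /set0Pn[x xB] jB] := h1 i ij; split.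
  exact: disjointWl sB dSA.
by have [a aA exa] := hA x (subsetP sB x xB); exists x, a.
Qed.

(** The contracted graph stays on the type [T], each fibre being named by its image under [f]; loops
    are dropped, multiple edges merge. *)
Definition quot f e : rel T :=
  [rel x y | (x != y) && [exists a, exists b, [&& f a == x, f b == y & e a b]]].

Lemma quotP f e x y :
  reflect (x <> y /\ exists a b, [/\ f a = x, f b = y & e a b]) (quot f e x y).
Proof.
apply: (iffP andP) => [[/eqP nxy /existsP[a /existsP[b /and3P[/eqP fa /eqP fb eab]]]]|].
  by split=> //; exists a, b.
move=> [/eqP nxy [a [b [fa fb eab]]]]; split=> //.
by apply/existsP; exists a; apply/existsP; exists b; rewrite fa fb !eqxx.
Qed.

Lemma quot_sym f e : symmetric e -> symmetric (quot f e).
Proof.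
move=> se; have h x y : quot f e x y -> quot f e y x.
  case/quotP=> nxy [a [b [fa fb eab]]]; apply/quotP; split; first by move/esym.
  by exists b, a; rewrite se.
by move=> x y; apply/idP/idP; apply: h.
Qed.

Lemma quot_irr f e : irreflexive (quot f e).
Proof. by move=> x; rewrite /quot /= eqxx. Qed.

(* The fibres of f over S' are stars centred at their image, hence connected. *)
Lemma Kminor_quot t f e S S' : symmetric e ->
  (forall x, x \in S' -> f x = x) ->
  (forall a, f a \in S' -> a \in S /\ (f a = a \/ e a (f a))) ->
  Kminor t (quot f e) S' -> Kminor t e S.
Proof.
move=> se fid fst [B [h1 h2]]; exists (fun i => [set a | f a \in B i]).
have BS i : i < t -> {subset B i <= S'} by move=> /h1[/subsetP].
split=> [i it|i j ij jt].
  have [_ /set0Pn[x0 x0B] jB] := h1 i it; set B' := [set a | _]; split.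
  - by apply/subsetP=> a; rewrite inE => /(BS i it)/fst[].
  - by apply/set0Pn; exists x0; rewrite inE fid // (BS i it).
  have inB x : x \in B i -> x \in B' by move=> xB; rewrite inE fid // (BS i it).
  have to_img a : a \in B' -> connect (within e B') a (f a) /\
                              connect (within e B') (f a) a.
    move=> aB; have aB' := aB; rewrite inE in aB'.
    have [_ [->|efa]] := fst a (BS i it _ aB'); first by split; apply: connect0.
    by split; apply: connect1; rewrite /within /= aB inB // ?efa // se efa.
  have sub : subrel (connect (within (quot f e) (B i))) (connect (within e B')).
    apply: connect_sub => x y /and3P[xB yB /quotP[_ [a [b [fa fb eab]]]]].
    have aB : a \in B' by rewrite inE fa.
    have bB : b \in B' by rewrite inE fb.
    have [_ c1] := to_img a aB; have [c2 _] := to_img b bB.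
    rewrite fa in c1; rewrite fb in c2.
    apply: connect_trans c1 (connect_trans _ c2).
    by apply: connect1; rewrite /within /= aB bB.
  move=> x y xB yB.
  have [c1 _] := to_img x xB; have [_ c2] := to_img y yB.
  apply: connect_trans c1 (connect_trans (sub _ _ _) c2).
  by rewrite !inE in xB yB; apply: jB.
have [dB [x [y [xB yB /quotP[_ [a [b [fa fb eab]]]]]]]] := h2 i j ij jt; split.
  rewrite disjoint_subset; apply/subsetP=> z; rewrite !inE => zi.
  by rewrite (disjointFr dB zi).
by exists a, b; rewrite !inE fa fb.
Qed.

Definition nbr e S x : {set T} := [set y in S | e x y].

(** Ordered pairs are counted, so this is twice the number of edges and [q * #|S| <= arcs e S] says
    that the average degree is at least [q]. *)
Definition arcs e S := \sum_(x in S) #|nbr e S x|.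

Definition contract (u v : T) : T -> T := fun a => if a == v then u else a.

(** Contracting uv destroys the edge uv and merges two edges into one for each common neighbour;
    every edge counts as two arcs. *)
Lemma arcs_contract e S u v : symmetric e -> irreflexive e ->
  u \in S -> v \in S -> e u v ->
  arcs e S <= arcs (quot (contract u v) e) (S :\ v) + 2 + 2 * #|nbr e S u :&: nbr e S v|.
Proof.
move=> se ie uS vS euv; set f := contract u v; set e' := quot f e.
have nuv : u != v by apply/eqP => h; rewrite h ie in euv.
have fv : f v = u by rewrite /f /contract eqxx.
have fx x : x != v -> f x = x by rewrite /f /contract => /negbTE->.
have uS' : u \in S :\ v by rewrite !inE nuv.
rewrite /arcs (big_setD1 v) // (big_setD1 u) //= [in X in _ <= X](big_setD1 u) //=.
set R := (S :\ v) :\ u.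
have e'I x y a b : x != y -> f a = x -> f b = y -> e a b -> e' x y.
  by move=> /eqP nxy fa fb eab; apply/quotP; split=> //; exists a, b.
have hu : #|nbr e S v| + #|nbr e S u| <= #|nbr e' (S :\ v) u| + 2 + #|nbr e S u :&: nbr e S v|.
  rewrite addnC -cardsUI leq_add2r.
  rewrite (cardsD1 u) (cardsD1 v (_ :\ u)).
  have le : #|(nbr e S u :|: nbr e S v) :\ u :\ v| <= #|nbr e' (S :\ v) u|.
    apply: subset_leq_card; apply/subsetP=> y; rewrite !inE => /and3P[yv yu h].
    have yS : y \in S by case/orP: h => /andP[].
    rewrite yv yS /=; case/orP: h => /andP[_ h].
      by rewrite eq_sym in yu; apply: (e'I _ _ u y) => //; rewrite fx.
    by rewrite eq_sym in yu; apply: (e'I _ _ v y) => //; rewrite fx.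
  by case: (u \in _); case: (v \in _); lia.
have hx x : x \in R -> #|nbr e S x| <= #|nbr e' (S :\ v) x| + (x \in nbr e S u :&: nbr e S v).
  rewrite !inE => /and3P[xu xv xS].
  rewrite xS /= (cardsD1 v) (cardsD1 u) !inE vS uS nuv /= (se u x) (se v x).
  rewrite [in X in _ <= X](cardsD1 u) !inE nuv uS /=.
  have le : #|nbr e S x :\ v :\ u| <= #|nbr e' (S :\ v) x :\ u|.
    apply: subset_leq_card; apply/subsetP=> y; rewrite !inE => /and4P[yu yv yS exy].
    rewrite yu yv yS /=; case: (x =P y) => [xy|/eqP nxy]; first by rewrite xy ie in exy.
    by apply: (e'I _ _ x y) => //; rewrite fx.
  have l2 : (e x u || e x v) <= e' x u.
    case: orP => // h; suff -> : e' x u by [].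
    case: h => h; first by apply: (e'I _ _ x u) => //; rewrite fx.
    by apply: (e'I _ _ x v) => //; rewrite fx.
  by move: l2 le; case: (e x u); case: (e x v); case: (e' x u) => //=; lia.
have hR : \sum_(i in R) #|nbr e S i| <=
    \sum_(i in R) #|nbr e' (S :\ v) i| + #|nbr e S u :&: nbr e S v|.
  apply: leq_trans (leq_sum _ hx) _; rewrite big_split /= leq_add2l.
  rewrite -sum1_card [X in X <= _]big_mkcond [X in _ <= X]big_mkcond /=.
  by apply: leq_sum => i _; case: (i \in R); case: (i \in _).
by lia.
Qed.

Lemma sum_gt0_ex (I : finType) (A : {set I}) (F : I -> nat) :
  0 < \sum_(i in A) F i -> exists2 i, i \in A & 0 < F i.
Proof.
rewrite lt0n sum_nat_eq0 => /forallPn[i]; rewrite negb_imply => /andP[iA Fi].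
by exists i; rewrite ?lt0n.
Qed.

Lemma sum_lt_ex (I : finType) (A : {set I}) (F : I -> nat) q :
  \sum_(i in A) F i < q * #|A| -> exists2 i, i \in A & F i < q.
Proof.
rewrite mulnC -sum_nat_const => h.
case: (boolP [exists i in A, F i < q]) => [/exists_inP[i iA Fi]|]; first by exists i.
rewrite negb_exists_in => /forall_inP hF.
suff : \sum_(i in A) q <= \sum_(i in A) F i by rewrite leqNgt h.
by apply: leq_sum => i /hF; rewrite -leqNgt.
Qed.

(* If no edge can be contracted cheaply, every neighbourhood is dense enough for the induction on t. *)
Lemma Kminor_of_arcs t e S : symmetric e -> irreflexive e ->
  S != set0 -> expn 2 t * #|S| <= arcs e S -> Kminor t.+2 e S.
Proof.
elim: t e S => [|t IHt] e S.
  move=> se ie S0; rewrite mul1n => h.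
  have : 0 < arcs e S by apply: leq_trans h; rewrite card_gt0.
  case/sum_gt0_ex => x xS; rewrite card_gt0 => /set0Pn[y]; rewrite inE => /andP[yS exy].
  exists (fun i => if i == 0 then [set x] else [set y]); split=> [i it|i j ij jt].
    by case: eqP => _; rewrite sub1set; split=> //; try exact: joined1;
       apply/set0Pn; [exists x | exists y]; rewrite inE.
  have -> : i = 0 by lia.
  have -> : j = 1 by lia.
  split=> /=; last by exists x, y; rewrite !inE.
  rewrite disjoints1 inE; apply/eqP => xy; by rewrite xy ie in exy.
have [n] := ubnP #|S|; elim: n => // n IHn in e S *.
move=> Sn se ie S0 hS.
have S_gt0 : 0 < #|S| by rewrite card_gt0.
have arcs_gt0 : 0 < arcs e S by apply: leq_trans hS; rewrite muln_gt0 expn_gt0 S_gt0.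
(* An edge with fewer than 2^t common neighbours is cheap: contracting it removes one vertex and at
   most 2 + 2(2^t - 1) = 2^(t+1) arcs, so the density bound survives. *)
case: (boolP [exists u in S, exists v in S,
    e u v && (#|nbr e S u :&: nbr e S v| < expn 2 t)]).
  case/exists_inP=> u uS /exists_inP[v vS /andP[euv tri]].
  have nuv : u != v by apply/eqP => h; rewrite h ie in euv.
  have cS := cardsD1 v S; rewrite vS in cS.
  have ha := arcs_contract se ie uS vS euv.
  apply: (@Kminor_quot _ (contract u v) e S (S :\ v)) => //.
  - by move=> x; rewrite !inE /contract => /andP[/negbTE->].
  - move=> a; rewrite /contract; case: eqP => [->|_].
      by move=> _; split=> //; right; rewrite se.
    by rewrite !inE => /andP[_ aS]; split=> //; left.
  apply: IHn.
  - by lia.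
  - exact: quot_sym.
  - exact: quot_irr.
  - by apply/set0Pn; exists u; rewrite !inE nuv.
  - by rewrite expnS in hS *; nia.
rewrite negb_exists_in => /forall_inP hE.
case/sum_gt0_ex: arcs_gt0 => v vS; rewrite card_gt0 => N0.
set N := nbr e S v in N0.
have tri x : x \in N -> expn 2 t <= #|nbr e N x|.
  rewrite inE => /andP[xS evx].
  have := hE v vS; rewrite negb_exists_in => /forall_inP/(_ x xS).
  rewrite evx /= -leqNgt => /leq_trans; apply; apply: subset_leq_card.
  by apply/subsetP=> y; rewrite !inE => /andP[/andP[-> ->] /andP[_ ->]].
have KN : Kminor t.+2 e N.
  apply: IHt => //; rewrite /arcs mulnC -sum_nat_const.
  exact: leq_sum.
apply: (@Kminor_sub _ _ (N :|: [set v])).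
  by apply/subsetP=> y; rewrite !inE => /orP[/andP[]|/eqP->].
apply: Kminor_apex => //.
- exact: joined1.
- by apply/set0Pn; exists v; rewrite inE.
- by rewrite disjoint_sym disjoints1 inE ie andbF.
- by move=> x; rewrite inE => /andP[_ evx]; exists v; rewrite ?inE // se.
Qed.

End Minors.

(** * K5 has no drawing *)

Section Turning.
Local Open Scope R_scope.
Notation pt := (R * R)%type.
Implicit Types (u v p q : pt) (l : seq pt).

Definition vsub u v : pt := (fst u - fst v, snd u - snd v).
(** Distances are taken in the sup norm, which keeps all estimates linear in the coordinates. *)
Definition close r u v : Prop := Rabs (fst u - fst v) < r /\ Rabs (snd u - snd v) < r.
Definition apart r u v : Prop := r <= Rabs (fst u - fst v) \/ r <= Rabs (snd u - snd v).

(* Half-open upper half-plane, so that exactly one of v and -v lies in it when v <> 0. *)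
Definition upper v : bool :=
  if Rlt_dec 0 (snd v) then true
  else if Rlt_dec (snd v) 0 then false
  else if Rlt_dec 0 (fst v) then true else false.

Definition posx v : bool := if Rlt_dec 0 (fst v) then true else false.

(* Crossing of the positive horizontal half-axis; meaningful only when v is close to u. *)
Definition step u v : bool := (upper u (+) upper v) && posx u.

(** A walk is a start [p] followed by the points of [l]. The map [d] produces the vector to be
    followed, so the fixed point can stand on either side of the difference. *)
Fixpoint turn (d : pt -> pt) p l : bool :=
  if l is q :: l' then step (d p) (d q) (+) turn d q l' else false.

Fixpoint fine r p l : Prop :=
  if l is q :: l' then close r p q /\ fine r q l' else True.

Lemma upper_opp u v : (0 < Rabs (fst u - fst v) \/ 0 < Rabs (snd u - snd v)) ->
  upper (vsub v u) = ~~ upper (vsub u v).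
Proof.
rewrite /upper /vsub /= => h.
by repeat (case: Rlt_dec => ?); try (exfalso; lra); try done;
   exfalso; case: h; rewrite /Rabs; case: Rcase_abs => *; lra.
Qed.

(** Negating the vectors exchanges the positive and the negative half-axis, and the crossings of
    both together are exactly the changes of half-plane. *)
Lemma step_opp r a b q : 0 < r -> close r a b -> apart (4 * r) a q -> apart (4 * r) b q ->
  step (vsub q a) (vsub q b) =
  step (vsub a q) (vsub b q) (+) (upper (vsub a q) (+) upper (vsub b q)).
Proof.
move=> r0 cab aq bq.
have ha : upper (vsub q a) = ~~ upper (vsub a q).
  by apply: upper_opp; case: aq; [left|right]; lra.
have hb : upper (vsub q b) = ~~ upper (vsub b q).
  by apply: upper_opp; case: bq; [left|right]; lra.
rewrite /step ha hb.
case E : (upper (vsub a q) (+) upper (vsub b q)); last first.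
  by move: E; case: (upper (vsub a q)); case: (upper (vsub b q)).
have -> : ~~ upper (vsub a q) (+) ~~ upper (vsub b q) = true.
  by move: E; case: (upper (vsub a q)); case: (upper (vsub b q)).
(* A change of half-plane within a distance [r] makes both ordinates small, so the separation from
   [q] must come from the abscissa, whose sign is then definite. *)
have : Rabs (snd a - snd q) < r /\ Rabs (snd b - snd q) < r.
  move: E cab; rewrite /upper /close /vsub /=.
  repeat (case: Rlt_dec => ?) => //=; move=> _ [_];
  rewrite /Rabs; do 3 (case: Rcase_abs => ?); split; lra.
move=> [ya yb]; move: aq; rewrite /apart /posx /vsub /= => -[xa|]; last lra.
move: xa; rewrite /Rabs; case: Rcase_abs => ?; do 2 (case: Rlt_dec => ?) => //= *; exfalso; lra.
Qed.

(** The four differences form a small closed quadrilateral far from the origin; it does not wind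
    around the origin, so it crosses the half-axis an even number of times. *)
Lemma square r a b p q : 0 < r -> close r a b -> close r p q ->
  apart (4 * r) a p -> apart (4 * r) a q -> apart (4 * r) b p -> apart (4 * r) b q ->
  step (vsub a p) (vsub b p) (+) step (vsub a q) (vsub b q) =
  step (vsub a p) (vsub a q) (+) step (vsub b p) (vsub b q).
Proof.
move=> r0 cab cpq hap haq hbp hbq.
set uap := upper (vsub a p); set ubp := upper (vsub b p).
set uaq := upper (vsub a q); set ubq := upper (vsub b q).
have hu c s : upper (vsub c s) -> 0 <= snd c - snd s.
  by rewrite /upper /vsub /=; repeat (case: Rlt_dec => ?) => //; lra.
have hl c s : upper (vsub c s) = false -> snd c - snd s <= 0.
  by rewrite /upper /vsub /=; repeat (case: Rlt_dec => ?) => //; lra.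
case E : [|| uap (+) ubp, uap (+) uaq | uap (+) ubq]; last first.
  by rewrite /step -/uap -/ubp -/uaq -/ubq; move: E; case: uap; case: ubp; case: uaq; case: ubq.
(* Some two differences lie in different half-planes, and any two differ by less than 2r in each
   coordinate. So all ordinates are small, all abscissas are at least 4r in absolute value, and
   their signs agree. *)
have [h1 [h2 h3]] : (posx (vsub a q) = posx (vsub a p)) /\
   (posx (vsub b p) = posx (vsub a p)) /\ (posx (vsub b q) = posx (vsub a p)).
  have xs c s : apart (4 * r) c s -> Rabs (snd c - snd s) < 3 * r -> 4 * r <= Rabs (fst c - fst s).
    by case; lra.
  have [y1 [y2 [y3 y4]]] : Rabs (snd a - snd p) < 3 * r /\ Rabs (snd a - snd q) < 3 * r /\
     Rabs (snd b - snd p) < 3 * r /\ Rabs (snd b - snd q) < 3 * r.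
    move: (hu a p) (hl a p) (hu a q) (hl a q) (hu b p) (hl b p) (hu b q) (hl b q).
    rewrite -/uap -/ubp -/uaq -/ubq; move: cab cpq E => [_ cab] [_ cpq].
    move: cab cpq => /Rabs_def2 c1 /Rabs_def2 c2;
    case: uap; case: ubp; case: uaq; case: ubq => // _;
    do 8 first [move=> /(_ erefl) ? | move=> _]; repeat split; apply: Rabs_def1; lra.
  move: (xs _ _ hap y1) (xs _ _ haq y2) (xs _ _ hbp y3) (xs _ _ hbq y4) => {}hap {}haq {}hbp {}hbq.
  move: cab cpq => [cab _] [cpq _]; rewrite /posx /vsub /=.
  move: cab cpq => /Rabs_def2 c1 /Rabs_def2 c2.
  move: hap haq hbp hbq; rewrite /Rabs.
  do 4 (case: Rcase_abs => ?); do 4 (case: Rlt_dec => ?); intros; try (exfalso; lra); repeat split.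
rewrite /step h1 h2; case: (posx _) => /=; rewrite ?andbT ?andbF // -/uap -/ubp -/uaq -/ubq.
by clear E; case: uap; case: ubp; case: uaq; case: ubq.
Qed.

Definition far r p l q l' : Prop :=
  forall u v, List.In u (p :: l) -> List.In v (q :: l') -> apart (4 * r) u v.

Lemma apart_sym r u v : apart r u v -> apart r v u.
Proof. by rewrite /apart (Rabs_minus_sym (fst u)) (Rabs_minus_sym (snd u)). Qed.

Lemma last_In p l : List.In (last p l) (p :: l).
Proof. by elim: l p => [|q l IHl] p /=; [left | right; apply: IHl]. Qed.

(** Add [square] along the second walk: the steps across inner points cancel in pairs. *)
Lemma turn_strip r a b q l : 0 < r -> close r a b -> fine r q l ->
  (forall v, List.In v (q :: l) -> apart (4 * r) a v /\ apart (4 * r) b v) ->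
  step (vsub a q) (vsub b q) (+) step (vsub a (last q l)) (vsub b (last q l)) =
  turn (vsub a) q l (+) turn (vsub b) q l.
Proof.
move=> r0 cab; elim: l q => [|q' l IHl] q /=; first by move=> _ _; rewrite addbb.
move=> [cq fl] h.
have [hq1 hq2] := h q (or_introl erefl).
have [hq1' hq2'] := h q' (or_intror (or_introl erefl)).
have IH := IHl q' fl (fun v hv => h v (or_intror hv)).
have sq := square r0 cab cq hq1 hq1' hq2 hq2'.
move: IH sq.
do 2 case: (step _ _); do 3 case: (step _ _); case: (turn _ _ _); case: (turn _ _ _) => //.
Qed.

(** Add [turn_strip] along the first walk: the inner turns of the second walk cancel in pairs. *)
Lemma turn_rect r p l q l' : 0 < r -> fine r p l -> fine r q l' -> far r p l q l' ->
  turn (vsub^~ q) p l (+) turn (vsub^~ (last q l')) p l =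
  turn (vsub p) q l' (+) turn (vsub (last p l)) q l'.
Proof.
move=> r0 + fq; elim: l p => [|p' l IHl] p /=; first by move=> _ _; rewrite addbb.
move=> [cp fl] h.
have IH := IHl p' fl (fun u v hu => h u v (or_intror hu)).
have st := turn_strip r0 cp fq (fun v hv => conj (h p v (or_introl erefl) hv)
   (h p' v (or_intror (or_introl erefl)) hv)).
move: IH st.
case: (turn _ _ _); case: (turn _ _ _); case: (turn _ _ _); case: (turn _ _ _);
case: (turn _ _ _); case: (step _ _); case: (step _ _) => //.
Qed.

Lemma turn_opp r a q l : 0 < r -> fine r q l ->
  (forall v, List.In v (q :: l) -> apart (4 * r) a v) ->
  turn (vsub a) q l = turn (vsub^~ a) q l (+) (upper (vsub q a) (+) upper (vsub (last q l) a)).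
Proof.
move=> r0; elim: l q => [|q' l IHl] q /=; first by move=> _ _; rewrite addbb.
move=> [cq fl] h.
rewrite (IHl q' fl (fun v hv => h v (or_intror hv))).
rewrite (step_opp r0 cq); last 2 first.
- by apply/apart_sym/h; left.
- by apply/apart_sym/h; right; left.
case: (upper _); case: (upper _); case: (upper _); case: (turn _ _ _); case: (step _ _) => //.
Qed.

(** [turn_opp] replaces the vectors on the right of [turn_rect] by their negatives, at the cost of
    half-plane bits that depend on the four end points only. *)
Lemma turn_disjoint r p l q l' : 0 < r -> fine r p l -> fine r q l' -> far r p l q l' ->
  (turn (vsub^~ q) p l (+) turn (vsub^~ (last q l')) p l) (+)
  (turn (vsub^~ p) q l' (+) turn (vsub^~ (last p l)) q l') =
  (upper (vsub q p) (+) upper (vsub (last q l') p)) (+)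
  (upper (vsub q (last p l)) (+) upper (vsub (last q l') (last p l))).
Proof.
move=> r0 fp fq h; rewrite (turn_rect r0 fp fq h).
rewrite (turn_opp r0 fq (fun v => h p v (or_introl erefl))).
rewrite (turn_opp r0 fq (fun v => h _ v (last_In p l))).
set a := turn _ _ _; set b := turn _ _ _.
by case: a; case: b; case: (upper _); case: (upper _); case: (upper _); case: (upper _).
Qed.

(* Summing turn_disjoint over the 15 pairs of disjoint edges of K5 cancels the left-hand sides. *)
Lemma K5_not_drawable r (P : nat -> pt) (L : nat -> nat -> seq pt) : 0 < r ->
  (forall i j : nat, (i < j < 5)%nat -> last (P i) (L i j) = P j) ->
  (forall i j : nat, (i < j < 5)%nat -> fine r (P i) (L i j)) ->
  (forall i j : nat, (i < j < 5)%nat -> apart (4 * r) (P i) (P j)) ->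
  (forall i j k l : nat, (i < j < 5)%nat -> (k < l < 5)%nat -> i != k -> i != l -> j != k -> j != l ->
     far r (P i) (L i j) (P k) (L k l)) -> False.
Proof.
move=> r0 hlast hfine hP hfar.
pose n i j k := turn (vsub^~ (P k)) (P i) (L i j).
pose h i j := upper (vsub (P i) (P j)).
have key i j k (l : nat) : (i < j < 5)%nat -> (k < l < 5)%nat ->
    i != k -> i != l -> j != k -> j != l ->
    xorb (xorb (xorb (n i j k) (n i j l)) (xorb (n k l i) (n k l j)))
         (xorb (xorb (h k i) (h l i)) (xorb (h k j) (h l j))) = false.
  move=> ij kl ik il jk jl.
  have := @turn_disjoint r _ _ _ _ r0 (hfine i j ij) (hfine k l kl) (hfar _ _ _ _ ij kl ik il jk jl).
  rewrite (hlast i j ij) (hlast k l kl) -!/(n _ _ _) -!/(h _ _).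
  by case: (n _ _ _); case: (n _ _ _); case: (n _ _ _); case: (n _ _ _);
     case: (h _ _); case: (h _ _); case: (h _ _); case: (h _ _).
have anti i j : (i < j < 5)%nat -> h j i = xorb true (h i j).
  move=> ij; rewrite /h (@upper_opp (P i) (P j)) //.
  by case: (hP i j ij) => ?; [left|right]; lra.
have X : forall a b : bool, a = false -> b = false -> xorb a b = false by move=> a b -> ->.
have := X _ _ (key 0 1 2 3 erefl erefl erefl erefl erefl erefl)%nat
 (X _ _ (key 0 1 2 4 erefl erefl erefl erefl erefl erefl)%nat
 (X _ _ (key 0 1 3 4 erefl erefl erefl erefl erefl erefl)%nat
 (X _ _ (key 0 2 1 3 erefl erefl erefl erefl erefl erefl)%nat
 (X _ _ (key 0 2 1 4 erefl erefl erefl erefl erefl erefl)%nat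
 (X _ _ (key 0 2 3 4 erefl erefl erefl erefl erefl erefl)%nat
 (X _ _ (key 0 3 1 2 erefl erefl erefl erefl erefl erefl)%nat
 (X _ _ (key 0 3 1 4 erefl erefl erefl erefl erefl erefl)%nat
 (X _ _ (key 0 3 2 4 erefl erefl erefl erefl erefl erefl)%nat
 (X _ _ (key 0 4 1 2 erefl erefl erefl erefl erefl erefl)%nat
 (X _ _ (key 0 4 1 3 erefl erefl erefl erefl erefl erefl)%nat
 (X _ _ (key 0 4 2 3 erefl erefl erefl erefl erefl erefl)%nat
 (X _ _ (key 1 2 3 4 erefl erefl erefl erefl erefl erefl)%nat
 (X _ _ (key 1 3 2 4 erefl erefl erefl erefl erefl erefl)%nat
  (key 1 4 2 3 erefl erefl erefl erefl erefl erefl)%nat))))))))))))).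
(* Each count [n i j k] occurs in two of the 15 identities and each pair of points in six. Of these
   60 half-plane bits, 45 have the larger index first; turning them round leaves an odd number of
   [true]. The final [ring] works in the field with two elements. *)
rewrite (anti 0 1)%nat // (anti 0 2)%nat // (anti 0 3)%nat // (anti 0 4)%nat // (anti 1 2)%nat //
  (anti 1 3)%nat // (anti 1 4)%nat // (anti 2 3)%nat // (anti 2 4)%nat // (anti 3 4)%nat //.
move=> E; suff : true = false by [].
rewrite -{}E; ring.
Qed.

End Turning.

(** * Separation of arcs and sampling of walks *)

Section Drawing.
Local Open Scope R_scope.
Notation pt := (R * R)%type.

Lemma fin_uniform_pos (I : finType) (P : I -> R -> Prop) :
  (forall i r r', 0 < r' <= r -> P i r -> P i r') ->
  (forall i, exists2 r, 0 < r & P i r) -> exists2 r, 0 < r & forall i, P i r.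
Proof.
move=> mono ex.
have [r r0 h] : exists2 r, 0 < r & forall i, i \in enum I -> P i r.
  elim: (enum I) => [|i s [r r0 IH]]; first by exists 1; [lra|].
  have [r' r'0 h] := ex i; exists (Rmin r r'); first exact: Rmin_pos.
  move=> j; rewrite inE => /orP[/eqP->|js].
    by apply: mono h; split; [apply: Rmin_pos | apply: Rmin_r].
  by apply: mono (IH j js); split; [apply: Rmin_pos | apply: Rmin_l].
by exists r => // i; apply: h; rewrite mem_enum.
Qed.

Lemma continuity_pt_eps (a : R -> R) u eps : continuity_pt a u -> 0 < eps ->
  exists2 d, 0 < d & forall x, Rabs (x - u) < d -> Rabs (a x - a u) < eps.
Proof.
move=> ca e0; have [d [d0 h]] := ca eps e0; exists d => // x xu.
case: (Req_dec u x) => [->|ne]; first by rewrite Rminus_diag Rabs_R0.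
by apply: (h x); split => //; split.
Qed.

(** Each function moves by less than a quarter of the initial gap, so half of it remains. One number
    serves as radius and as gap, as the compactness argument on the square requires. *)
Lemma local_gap (a b : R -> R) u v : continuity_pt a u -> continuity_pt b v -> a u <> b v ->
  exists2 d, 0 < d & forall x y, Rabs (x - u) < d -> Rabs (y - v) < d -> d <= Rabs (a x - b y).
Proof.
move=> ca cb ne; set g := Rabs (a u - b v).
have g0 : 0 < g by apply: Rabs_pos_lt; lra.
have [d1 d10 h1] := @continuity_pt_eps _ _ (g / 4) ca ltac:(lra).
have [d2 d20 h2] := @continuity_pt_eps _ _ (g / 4) cb ltac:(lra).
exists (Rmin (g / 2) (Rmin d1 d2)); first by repeat apply: Rmin_pos; lra.
move=> x y xu yv.
have le1 := Rmin_l (g / 2) (Rmin d1 d2); have le2 := Rmin_r (g / 2) (Rmin d1 d2).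
have le3 := Rmin_l d1 d2; have le4 := Rmin_r d1 d2.
have := h1 x ltac:(lra); have := h2 y ltac:(lra); move: le1.
by rewrite /g; set m := Rmin _ _; rewrite /Rabs; do 4 (case: Rcase_abs => ?); lra.
Qed.

Definition path_continuous (f : R -> pt) : Prop :=
  (forall t, continuity_pt (fun s => fst (f s)) t) /\
  (forall t, continuity_pt (fun s => snd (f s)) t).

Lemma paths_apart (f g : R -> pt) : path_continuous f -> path_continuous g ->
  (forall s t, 0 <= s <= 1 -> 0 <= t <= 1 -> f s <> g t) ->
  exists2 r, 0 < r & forall s t, 0 <= s <= 1 -> 0 <= t <= 1 -> apart r (f s) (g t).
Proof.
move=> [f1 f2] [g1 g2] ne.
have loc u v : exists d : posreal, 0 <= u <= 1 -> 0 <= v <= 1 ->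
    forall x y, Rabs (x - u) < d -> Rabs (y - v) < d -> apart d (f x) (g y).
  (* Off the unit square any radius will do; the value 1 makes the radius a total function. *)
  case: (classic (0 <= u <= 1 /\ 0 <= v <= 1)) => [[u1 v1]|nuv]; last first.
    by exists (mkposreal 1 Rlt_0_1) => ? ?; case: nuv.
  have : fst (f u) <> fst (g v) \/ snd (f u) <> snd (g v).
    apply: NNPP => h; apply: (ne u v u1 v1).
    by case: (f u) (g v) h => [? ?] [? ?] /= h; f_equal; apply: NNPP; tauto.
  case=> [h|h].
    have [d d0 hd] := local_gap (f1 u) (g1 v) h.
    by exists (mkposreal d d0) => _ _ x y xu yv; left; apply: hd.
  have [d d0 hd] := local_gap (f2 u) (g2 v) h.
  by exists (mkposreal d d0) => _ _ x y xu yv; right; apply: hd.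
pose dl u v := proj1_sig (constructive_indefinite_description _ (loc u v)).
have [d hd] := compactness_value_2d 0 1 0 1 dl.
exists d; first exact: cond_pos.
move=> s t s1 t1; apply: NNPP => na; apply: (hd s t s1 t1) => -[u [v [u1 [v1 [su [tv le]]]]]].
apply: na; have := proj2_sig (constructive_indefinite_description _ (loc u v)) u1 v1 s t su tv.
by move: le; rewrite -/(dl u v) /apart => le [?|?]; [left|right]; lra.
Qed.

Lemma path_uniform (f : R -> pt) r : path_continuous f -> 0 < r ->
  exists2 d, 0 < d & forall s t, 0 <= s <= 1 -> 0 <= t <= 1 -> Rabs (s - t) < d ->
    close r (f s) (f t).
Proof.
move=> [f1 f2] r0.
have [d1 h1] := @Heine_cor2 _ 0 1 (fun x _ => f1 x) (mkposreal r r0).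
have [d2 h2] := @Heine_cor2 _ 0 1 (fun x _ => f2 x) (mkposreal r r0).
exists (Rmin d1 d2); first by apply: Rmin_pos; apply: cond_pos.
move=> s t s1 t1 st; have := Rmin_l d1 d2; have := Rmin_r d1 d2 => *.
by split; [apply: h1 | apply: h2] => //; lra.
Qed.

Lemma fine_cat r p l1 l2 : fine r p l1 -> fine r (last p l1) l2 -> fine r p (l1 ++ l2).
Proof. by elim: l1 p => [//|q l1 IH] p /= [? ?] ?; split=> //; apply: IH. Qed.

Lemma fine_map_iota r (g : nat -> pt) m n :
  (forall k, (m <= k < m + n)%nat -> close r (g k) (g k.+1)) ->
  fine r (g m) [seq g k | k <- iota m.+1 n].
Proof.
elim: n m => [//|n IH] m h /=; split; first by apply: h; lia.
by apply: IH => k ?; apply: h; lia.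
Qed.

Lemma last_map_iota (g : nat -> pt) m n : last (g m) [seq g k | k <- iota m.+1 n] = g (m + n)%nat.
Proof. by elim: n m => [|n IH] m /=; rewrite ?addn0 // IH addnS. Qed.

Lemma In_map_iota (g : nat -> pt) m n u : List.In u [seq g k | k <- iota m n] ->
  exists2 k, (m <= k < m + n)%nat & u = g k.
Proof.
elim: n m => [//|n IH] m /= [<-|/IH[k ? ->]]; first by exists m => //; lia.
by exists k => //; lia.
Qed.

Variables (T : finType) (e : rel T) (pos : T -> pt) (arc : T -> T -> R -> pt) (N : nat).

Definition sample x y (k : nat) : pt := arc x y (INR k / INR N).

(** Sampling starts at [k = 1], since the point at 0 ends the previous edge, or is the start of the
    walk, which is stored apart. *)
Fixpoint trace x (p : seq T) : seq pt :=
  if p is y :: p' then [seq sample x y k | k <- iota 1 N] ++ trace y p' else [::].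

Hypothesis N0 : (0 < N)%nat.
Hypothesis arc0 : forall x y, e x y -> arc x y 0 = pos x.
Hypothesis arc1 : forall x y, e x y -> arc x y 1 = pos y.

Lemma INR_N_gt0 : 0 < INR N. Proof. by apply: lt_0_INR; lia. Qed.

Lemma frac_unit k : (k <= N)%nat -> 0 <= INR k / INR N <= 1.
Proof.
move=> kN; have h := INR_N_gt0; have := pos_INR k.
have : INR k <= INR N by apply: le_INR; lia.
move=> ? ?; split; first by apply: Rmult_le_pos => //; left; apply: Rinv_0_lt_compat.
by apply: (Rmult_le_reg_r (INR N)) => //; field_simplify; lra.
Qed.

Lemma sample0 x y : e x y -> sample x y 0 = pos x.
Proof. by move=> exy; rewrite /sample /= /Rdiv Rmult_0_l arc0. Qed.

Lemma sampleN x y : e x y -> sample x y N = pos y.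
Proof. by move=> exy; rewrite /sample Rdiv_diag ?arc1 //; have := INR_N_gt0; lra. Qed.

Lemma last_sample x y : e x y -> last (pos x) [seq sample x y k | k <- iota 1 N] = pos y.
Proof. by move=> exy; rewrite -(sample0 exy) last_map_iota add0n sampleN. Qed.

Lemma last_trace x p : path e x p -> last (pos x) (trace x p) = pos (last x p).
Proof.
elim: p x => [//|y p IH] x /= /andP[exy yp].
by rewrite last_cat last_sample // IH.
Qed.

Lemma fine_trace r x p : 
  (forall x y k, e x y -> (k < N)%nat -> close r (sample x y k) (sample x y k.+1)) ->
  path e x p -> fine r (pos x) (trace x p).
Proof.
move=> h; elim: p x => [//|y p IH] x /= /andP[exy yp].
apply: fine_cat; last by rewrite last_sample //; apply: IH.
by rewrite -(sample0 exy); apply: fine_map_iota => k ?; apply: h.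
Qed.

(** In a nonempty walk even the start lies on an arc with both ends in [A], so the distance of two
    walks reduces to distances of arcs. *)
Lemma In_trace (A : {set T}) x p u : path (within e A) x p -> p != [::] ->
  List.In u (pos x :: trace x p) ->
  exists y z t, [/\ y \in A, z \in A, e y z, 0 <= t <= 1 & u = arc y z t].
Proof.
have gen : path (within e A) x p -> List.In u (trace x p) ->
    exists y z t, [/\ y \in A, z \in A, e y z, 0 <= t <= 1 & u = arc y z t].
  elim: p x => [//|y p IH] x /= /andP[/and3P[xA yA exy] yp] /List.in_app_iff[|]; last exact: IH.
  case/In_map_iota => k kN ->; exists x, y, (INR k / INR N); split=> //.
  by apply: frac_unit; lia.
move=> pth p0 [<-|]; last exact: gen.
case: p pth p0 {gen} => [//|y p] /= /andP[/and3P[xA yA exy] _] _.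
by exists x, y, 0; split=> //; [lra | rewrite arc0].
Qed.

End Drawing.

(** * Planar graphs have no K5 minor *)

Section PlanarMinor.
Local Open Scope R_scope.
Variables (T : finType) (e : rel T).

(** Closed arcs of edges without a common end are disjoint: two ends differ by injectivity of [pos],
    an end is not interior to another arc, and interiors do not meet. *)
Lemma planar_arcs : planar e -> exists (pos : T -> R * R) (arc : T -> T -> R -> R * R),
  [/\ injective pos, forall x y, e x y -> path_continuous (arc x y),
      forall x y, e x y -> arc x y 0 = pos x, forall x y, e x y -> arc x y 1 = pos y &
      forall x y u v, e x y -> e u v -> x != u -> x != v -> y != u -> y != v ->
        forall s t, 0 <= s <= 1 -> 0 <= t <= 1 -> arc x y s <> arc u v t].
Proof.
case=> pos [arc [ipos [harc hdis]]]; exists pos, arc; split=> //.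
- by move=> x y /harc[? [? _]].
- by move=> x y /harc[_ [_ [? _]]].
- by move=> x y /harc[_ [_ [_ [? _]]]].
move=> x y u v exy euv xu xv yu yv s t s1 t1 E.
have [_ [_ [a0 [a1 [_ av]]]]] := harc x y exy.
have [_ [_ [b0 [b1 [_ bv]]]]] := harc u v euv.
have ends w : w = 0 \/ w = 1 \/ ~ (w = 0 \/ w = 1) by tauto.
have P a b : a != b -> pos a <> pos b by move=> /eqP ab /ipos.
case: (ends s) E => [->|[->|ns]]; case: (ends t) => [->|[->|nt]];
  rewrite ?a0 ?a1 ?b0 ?b1; try by apply: P.
- by move/esym; apply: bv; lra.
- by move/esym; apply: bv; lra.
- by apply: av; lra.
- by apply: av; lra.
- apply: hdis => //; try lra.
  by case=> -[/eqP h _]; move: h; rewrite ?(negbTE xu) ?(negbTE xv).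
Qed.

(* Disjoint edges of K5 are sent to walks through disjoint unions of branch sets, so the argument
   applies to minors directly; adjacent edges may overlap arbitrarily. *)
Lemma planar_no_K5_minor (S : {set T}) : symmetric e -> planar e -> ~ Kminor 5 e S.
Proof.
move=> se /planar_arcs[pos [arc [ipos carc arc0 arc1 disj]]] [B [hB hBB]].
have [r1 r10 h1] : exists2 r, 0 < r & forall q : (T * T) * (T * T),
    let: ((x, y), (u, v)) := q in
    e x y -> e u v -> x != u -> x != v -> y != u -> y != v ->
    forall s t, 0 <= s <= 1 -> 0 <= t <= 1 -> apart r (arc x y s) (arc u v t).
  apply: fin_uniform_pos => [[[x y] [u v]] r r' rr' h exy euv xu xv yu yv s t s1 t1|[[x y] [u v]]].
    by case: (h exy euv xu xv yu yv s t s1 t1) => ?; [left|right]; lra.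
  case: (boolP [&& e x y, e u v, x != u, x != v, y != u & y != v]).
    case/and5P=> exy euv xu xv /andP[yu yv].
    have [r r0 h] := paths_apart (carc _ _ exy) (carc _ _ euv) (disj _ _ _ _ exy euv xu xv yu yv).
    by exists r.
  move=> nb; exists 1; first by lra.
  by move=> h1 h2 h3 h4 h5 h6; rewrite h1 h2 h3 h4 h5 h6 in nb.
have [r2 r20 h2] : exists2 r, 0 < r & forall q : T * T, q.1 != q.2 -> apart r (pos q.1) (pos q.2).
  apply: fin_uniform_pos => [[x y] r r' rr' h xy|[x y] /=].
    by case: (h xy) => ?; [left|right]; lra.
  case: (x =P y) => [->|nxy]; first by exists 1 => //; lra.
  have ap : Rabs (fst (pos x) - fst (pos y)) > 0 \/ Rabs (snd (pos x) - snd (pos y)) > 0.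
    apply: NNPP => h; apply/nxy/ipos.
    have := Rabs_pos_lt (fst (pos x) - fst (pos y)).
    have := Rabs_pos_lt (snd (pos x) - snd (pos y)).
    by case: (pos x) (pos y) h => [? ?] [? ?] /= *; f_equal; apply: NNPP => ?; intuition lra.
  by case: ap => h; [exists (Rabs (fst (pos x) - fst (pos y))) | exists (Rabs (snd (pos x) - snd (pos y)))]
    => // _; [left|right]; lra.
(* The parity argument needs separation 4r between walks and between points. *)
pose r := Rmin r1 r2 / 4.
have m1 := Rmin_l r1 r2; have m2 := Rmin_r r1 r2.
have r0 : 0 < r by rewrite /r; have := Rmin_pos _ _ r10 r20; lra.
have [d d0 hd] : exists2 d, 0 < d & forall q : T * T, e q.1 q.2 -> forall s t,
    0 <= s <= 1 -> 0 <= t <= 1 -> Rabs (s - t) < d -> close r (arc q.1 q.2 s) (arc q.1 q.2 t).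
  apply: fin_uniform_pos => [[x y] d d' dd' h exy s t s1 t1 st|[x y] /=].
    by apply: h => //; lra.
  case: (boolP (e x y)) => [exy|_]; last by exists 1; [lra|].
  by have [d d0 h] := path_uniform (carc _ _ exy) r0; exists d.
have [N0 [hN0 N00]] := archimed_cor1 d d0.
have {}N00 : (0 < N0)%nat by lia.
have hfine x y k : e x y -> (k < N0)%nat -> close r (sample arc N0 x y k) (sample arc N0 x y k.+1).
  move=> exy kN; apply: (hd (x, y)) => //; try by apply: frac_unit; lia.
  have N0' := INR_N_gt0 N00.
  have -> : INR k / INR N0 - INR k.+1 / INR N0 = - / INR N0.
    by rewrite S_INR; field; lra.
  by rewrite Rabs_Ropp Rabs_pos_eq //; left; apply: Rinv_0_lt_compat.
have [_ /set0Pn[x0 _] _] := hB 0%nat erefl.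
pose rho i := odflt x0 [pick x in B i].
have rhoB i : (i < 5)%nat -> rho i \in B i.
  move=> i5; rewrite /rho; case: pickP => //= h.
  by have [_ /set0Pn[x]] := hB i i5; rewrite h.
have disB i j x : (i < 5)%nat -> (j < 5)%nat -> i != j -> x \in B i -> x \notin B j.
  move=> i5 j5 ij xi; case: (ltngtP i j) => h; last by rewrite h eqxx in ij.
    by have [dij _] := hBB i j h j5; rewrite (disjointFr dij xi).
  by have [dij _] := hBB j i h i5; rewrite (disjointFl dij xi).
have rho_ne i j : (i < 5)%nat -> (j < 5)%nat -> i != j -> rho i != rho j.
  move=> i5 j5 ij; apply/eqP => E.
  by have := disB i j _ i5 j5 ij (rhoB i i5); rewrite E rhoB.
(* Branch sets i and j together are connected. Outside the index range an empty walk serves as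
   default, so that a total function [W] can be chosen. *)
have walk i j : exists p, (i < j < 5)%nat ->
    path (within e (B i :|: B j)) (rho i) p /\ last (rho i) p = rho j.
  case: (boolP (i < j < 5)%nat) => [/andP[ij j5]|]; last by exists [::].
  have i5 : (i < 5)%nat by lia.
  have [_ _ ji] := hB i i5; have [_ _ jj] := hB j j5.
  have [_ [a [b [ai bj eab]]]] := hBB i j ij j5.
  have := joinedU se ji jj ai bj eab => /(_ (rho i) (rho j)).
  rewrite !inE !rhoB // orbT => /(_ isT isT)/connectP[p pp lp].
  by exists p.
pose W i j := proj1_sig (constructive_indefinite_description _ (walk i j)).
have hW i j : (i < j < 5)%nat ->
    path (within e (B i :|: B j)) (rho i) (W i j) /\ last (rho i) (W i j) = rho j.
  exact: (proj2_sig (constructive_indefinite_description _ (walk i j))).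
have hWe i j : (i < j < 5)%nat -> path e (rho i) (W i j).
  by move=> /hW[+ _]; apply: sub_path => x y /and3P[].
have hW0 i j : (i < j < 5)%nat -> W i j != [::].
  move=> ij; have [_] := hW i j ij; case: (W i j) => //= E.
  by have := rho_ne i j ltac:(lia) ltac:(lia) ltac:(lia); rewrite E eqxx.
apply: (@K5_not_drawable r (fun i => pos (rho i)) (fun i j => trace arc N0 (rho i) (W i j)) r0).
- by move=> i j ij; rewrite (last_trace N00 arc0 arc1) ?hWe //; have [_ ->] := hW i j ij.
- by move=> i j ij; apply: (fine_trace N00 arc0 arc1) => //; apply: hWe.
- move=> i j ij; have := h2 (rho i, rho j) (rho_ne i j ltac:(lia) ltac:(lia) ltac:(lia)).
  by rewrite /apart /r /=; case=> ?; [left|right]; lra.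
- move=> i j k l ij kl ik il jk jl u v.
  have [pij _] := hW i j ij; have [pkl _] := hW k l kl.
  case/(In_trace N00 arc0 pij (hW0 _ _ ij)) => y [z [t [yA zA eyz t1 ->]]].
  case/(In_trace N00 arc0 pkl (hW0 _ _ kl)) => y' [z' [t' [yA' zA' eyz' t1' ->]]].
  have ne a b : a \in B i :|: B j -> b \in B k :|: B l -> a != b.
    move=> ha hb; apply/eqP => E; rewrite -{}E in hb; move: ha hb; rewrite !inE.
    by case/orP=> ha; apply/negP; rewrite negb_or; apply/andP; split; apply: disB ha => //; lia.
  have := h1 ((y, z), (y', z')) eyz eyz' (ne _ _ yA yA') (ne _ _ yA zA') (ne _ _ zA yA') (ne _ _ zA zA') t t' t1 t1'.
  by rewrite /apart /r; case=> ?; [left|right]; lra.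
Qed.

End PlanarMinor.

(** * Colourings *)

Section Colouring.
Variable T : finType.
Implicit Types (e r : rel T) (S A H X N : {set T}) (f : T -> T).

Lemma free_colour (N : {set T}) (c : T -> nat) q : #|N| < q ->
  exists2 i, i < q & forall y, y \in N -> c y != i.
Proof.
move=> Nq; pose img : {set 'I_q} := [set i : 'I_q | [exists y in N, c y == i]].
have le : #|img| <= #|N|.
  have q0 : 0 < q by lia.
  pose g y : 'I_q := if insub (c y) is Some i then i else Ordinal q0.
  apply: leq_trans (leq_imset_card g (mem N)); apply: subset_leq_card.
  apply/subsetP=> i; rewrite inE => /exists_inP[y yN /eqP cy].
  by apply/imsetP; exists y => //; rewrite /g cy insubT //= => h; apply/val_inj.
have /set0Pn[i] : ~: img != set0.
  by rewrite -card_gt0 cardsCs setCK card_ord subn_gt0; lia.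
rewrite !inE negb_exists_in => /forall_inP h; exists i => //.
Qed.

Definition proper r S q (c : T -> nat) : Prop :=
  (forall x, x \in S -> c x < q) /\
  (forall x y, x \in S -> y \in S -> r x y -> c x != c y).

(** The set [N] only has to show all colours seen by [x]; it may be smaller than the neighbourhood
    when neighbours share a colour. *)
Lemma proper_extend r S q c x (N : {set T}) : symmetric r -> irreflexive r ->
  (forall y, y \in S -> y != x -> r x y -> exists2 z, z \in N & c z = c y) ->
  #|N| < q -> proper r (S :\ x) q c -> exists c', proper r S q c'.
Proof.
move=> sr ir hN Nq [cq cp]; have [i iq hi] := free_colour c Nq.
exists (fun y => if y == x then i else c y); split=> [y yS|y z yS zS ryz].
  by case: eqP => [//|/eqP yx]; apply: cq; rewrite !inE yx.
case: (y =P x) => [yx|/eqP yx]; case: (z =P x) => [zx|/eqP zx].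
- by rewrite yx zx ir in ryz.
- by rewrite yx in ryz; have [w wN <-] := hN z zS zx ryz; rewrite eq_sym hi.
- by rewrite zx sr in ryz; have [w wN <-] := hN y yS yx ryz; rewrite hi.
- by apply: cp; rewrite // !inE ?yx ?zx.
Qed.

Lemma degenerate_colouring r S q : symmetric r -> irreflexive r ->
  (forall A, A \subset S -> A != set0 -> exists2 x, x \in A & #|nbr r A x| < q) ->
  exists c, proper r S q c.
Proof.
move=> sr ir; have [n] := ubnP #|S|; elim: n => // n IH in S * => Sn deg.
have [->|S0] := eqVneq S set0.
  by exists (fun _ => 0); split=> [x|x y]; rewrite inE.
have [x xS xq] := deg S (subxx S) S0.
have [|A AS|c cp] := IH (S :\ x).
- by have := cardsD1 x S; rewrite xS; lia.
- by apply: deg; apply: subset_trans AS (subsetDl _ _).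
apply: proper_extend sr ir _ xq cp => y yS yx rxy.
by exists y => //; rewrite inE yS rxy.
Qed.

(* A vertex v of degree at most 3 has two non-adjacent neighbours a, b, unless it has degree at
   most 2 or spans a K4; contracting a, v, b forces a and b to share a colour, so that v sees at most two. *)
Lemma no_K4_minor_colouring e S : symmetric e -> irreflexive e ->
  ~ Kminor 4 e S -> exists c, proper e S 3 c.
Proof.
have [n] := ubnP #|S|; elim: n => // n IH in e S *; move=> Sn se ie noK.
have [->|S0] := eqVneq S set0.
  by exists (fun _ => 0); split=> [x|x y]; rewrite inE.
(* Without a K4 minor the average degree is below 2^2, so some vertex has degree at most 3. *)
have [v vS v4] : exists2 v, v \in S & #|nbr e S v| < 4.
  apply: sum_lt_ex; rewrite ltnNge; apply/negP => h; apply: noK.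
  exact: (@Kminor_of_arcs _ 2).
have SvS : #|S :\ v| < n by have := cardsD1 v S; rewrite vS; lia.
set N := nbr e S v in v4.
case: (boolP [exists a in N, exists b in N, (a != b) && ~~ e a b]).
  case/exists_inP=> a; rewrite inE => /andP[aS eva] /exists_inP[b].
  rewrite inE => /andP[bS evb] /andP[nab neab].
  pose f x := if (x == a) || (x == b) then v else x.
  pose S' := S :\ a :\ b.
  have nva : v != a by apply/eqP => h; rewrite -h ie in eva.
  have nvb : v != b by apply/eqP => h; rewrite -h ie in evb.
  have fid x : x \in S' -> f x = x.
    by rewrite !inE /f => /and3P[/negbTE-> /negbTE->].
  have fS' x : f x \in S' -> x \in S /\ (f x = x \/ e x (f x)).
    rewrite /f; case: (x =P a) => [->|_] /=; first by split=> //; right; rewrite se.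
    case: (x =P b) => [->|_] /=; first by split=> //; right; rewrite se.
    by rewrite !inE => /and3P[_ _ xS]; split=> //; left.
  have fS x : x \in S -> f x \in S'.
    by rewrite /f; case: ifP => [_ _|/norP[xa xb] xS]; rewrite !inE ?nva ?nvb ?xa ?xb.
  have [||||c [cq cp]] := IH (quot f e) S'.
  - have := cardsD1 a S; have := cardsD1 b (S :\ a).
    rewrite !inE aS bS (eq_sym b) nab /S' /=.
    lia.
  - exact: quot_sym.
  - exact: quot_irr.
  - by move=> h; apply: noK; apply: (@Kminor_quot _ _ f e S S').
  (* Pulled back along [f], the colouring gives a and b the colour of the contracted vertex. This is
     proper because a and b are not adjacent and v is left out. *)
  have pr : proper e (S :\ v) 3 (c \o f).
    split=> [x|x y]; rewrite !inE => /andP[xv xS]; first by apply: cq; apply: fS.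
    move=> /andP[yv yS] exy; apply: cp; try exact: fS.
    apply/quotP; split; last by exists x, y.
    rewrite /f; case: ifP => [xab|_]; case: ifP => [yab|_].
    + move=> _; move: exy; have neba : e b a = false by rewrite se; apply: negbTE.
      by case/orP: xab => /eqP->; case/orP: yab => /eqP->; rewrite ?ie ?neba // (negbTE neab).
    + by move/esym=> E; rewrite E eqxx in yv.
    + by move=> E; rewrite E eqxx in xv.
    + by move=> E; rewrite E ie in exy.
  apply: (@proper_extend e S 3 _ v (N :\ a)) pr => //.
    move=> y yS yv evy; case: (y =P a) => [->|/eqP ya]; last by exists y; rewrite // !inE ya yS.
    by exists b; rewrite /= /f ?eqxx ?orbT // !inE eq_sym nab bS.
  by have := cardsD1 a N; rewrite !inE aS eva /=; lia.
rewrite negb_exists_in => /forall_inP clq.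
have {}clq a b : a \in N -> b \in N -> a != b -> e a b.
  move=> aN bN nab; have := clq a aN; rewrite negb_exists_in => /forall_inP/(_ b bN).
  by rewrite nab /= negbK.
(* Now the neighbourhood of v is a clique: with at most two vertices it leaves a colour for v, with
   three it forms a K4 together with v. *)
case: (leqP 3 #|N|) => N3; last first.
  have [||||c cp] := IH e (S :\ v) => //.
    by move=> h; apply: noK; apply: Kminor_sub h; apply: subsetDl.
  by apply: proper_extend se ie _ N3 cp => y yS _ evy; exists y; rewrite ?inE ?yS.
case: noK; apply: (@Kminor_sub _ _ _ (N :|: [set v])).
  by apply/subsetP=> y; rewrite !inE => /orP[/andP[]|/eqP->].
apply: Kminor_apex => //.
- exact: joined1.
- by apply/set0Pn; exists v; rewrite inE.
- by rewrite disjoint_sym disjoints1 inE ie andbF.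
- by move=> x; rewrite inE => /andP[_ evx]; exists v; rewrite ?inE // se.
have s3 : 2 < size (enum N) by rewrite -cardE.
exists (fun i => [set nth v (enum N) i]).
have iN i : i < 3 -> nth v (enum N) i \in N.
  by move=> i3; rewrite -mem_enum mem_nth //; apply: leq_trans i3 s3.
have ne i j : i < j -> j < 3 -> nth v (enum N) i != nth v (enum N) j.
  move=> ij j3; rewrite nth_uniq ?enum_uniq ?(ltn_eqF ij) //.
    exact: ltn_trans ij (leq_trans j3 s3).
  exact: leq_trans j3 s3.
split=> [i i3|i j ij j3].
  by rewrite sub1set iN //; split=> //; [apply/set0Pn; exists (nth v (enum N) i); rewrite inE | apply: joined1].
split; first by rewrite disjoints1 inE ne.
exists (nth v (enum N) i), (nth v (enum N) j); rewrite !inE !eqxx; split=> //.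
by apply: clq; [apply: iN; apply: ltn_trans ij j3 | apply: iN | apply: ne].
Qed.

End Colouring.

(** * Hubs and clusters *)

Section Hubs.
Variable T : finType.
Implicit Types (e r : rel T) (S A H X N : {set T}) (f : T -> T).

Definition touches e x A : bool := [exists a in A, e x a].

Definition remote e H : {set T} := [set x | (x \notin H) && ~~ touches e x H].

(* Each hub takes d vertices away from the remote part, so there are at most |T|/d of them. *)
Lemma hubs_exist e d : symmetric e -> 0 < d ->
  exists2 H : {set T}, #|H| * d <= #|T| & forall w, #|nbr e (remote e H) w| < d.
Proof.
move=> se d0.
suff gen n H : #|remote e H| < n -> #|H| * d + #|remote e H| <= #|T| ->
    exists2 H : {set T}, #|H| * d <= #|T| & forall w, #|nbr e (remote e H) w| < d.
  by apply: (gen _ set0 (ltnSn _)); rewrite cards0 max_card.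
elim: n H => // n IH H Hn hH.
case: (boolP [exists w, d <= #|nbr e (remote e H) w|]) => [/existsP[w hw]|]; last first.
  rewrite negb_exists => /forallP h; exists H; first by lia.
  by move=> w; have := h w; rewrite -ltnNge.
(* Making [w] a hub removes its at least [d] remote neighbours, which pays for the increase of
   [#|H| * d]. *)
have sub : remote e (w |: H) \subset remote e H :\: nbr e (remote e H) w.
  apply/subsetP=> x; rewrite !inE negb_or => /andP[/andP[xw xH] nt].
  have nexw : ~~ e x w.
    by apply: contra nt => exw; apply/exists_inP; exists w; rewrite ?inE ?eqxx.
  have ntH : ~~ touches e x H.
    apply: contra nt => /exists_inP[a aH exa]; apply/exists_inP.
    by exists a => //; rewrite inE aH orbT.
  by rewrite xH ntH /= ?andbT se nexw.
have c1 := subset_leq_card sub.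
have c2 : #|remote e H :\: nbr e (remote e H) w| = #|remote e H| - #|nbr e (remote e H) w|.
  by rewrite cardsD (setIidPr _) //; apply/subsetP=> x; rewrite inE => /andP[].
have c3 : #|nbr e (remote e H) w| <= #|remote e H|.
  by apply: subset_leq_card; apply/subsetP=> x; rewrite inE => /andP[].
have c4 : #|w |: H| <= #|H|.+1 by rewrite cardsU1; case: (w \notin H).
by apply: (IH (w |: H)); [lia | nia].
Qed.

(* Starting from singletons, merge two clusters through at most two further vertices as long as
   possible; |cover P| + 2 |P| does not increase. *)
Lemma clusters_exist e H : symmetric e ->
  exists P : {set {set T}},
   [/\ forall A, A \in P -> joined e A /\ A != set0, H \subset cover P, #|cover P| <= 3 * #|H| &
       forall x y A B, x \notin cover P -> y \notin cover P -> A \in P -> B \in P ->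
         (x == y) || e x y -> touches e x A -> touches e y B -> A = B].
Proof.
move=> se.
suff gen n (P : {set {set T}}) : #|P| < n -> (forall A, A \in P -> joined e A /\ A != set0) ->
    H \subset cover P -> #|cover P| + 2 * #|P| <= 3 * #|H| -> exists P : {set {set T}},
   [/\ forall A, A \in P -> joined e A /\ A != set0, H \subset cover P, #|cover P| <= 3 * #|H| &
       forall x y A B, x \notin cover P -> y \notin cover P -> A \in P -> B \in P ->
         (x == y) || e x y -> touches e x A -> touches e y B -> A = B].
  pose P : {set {set T}} := [set [set h] | h in H].
  have cP : cover P = H.
    apply/setP=> x; apply/bigcupP/idP => [[A /imsetP[h hH ->]]|xH].
      by rewrite inE => /eqP->.
    by exists [set x]; rewrite ?inE //; apply/imsetP; exists x.
  apply: (gen _ P (ltnSn _)); rewrite ?cP //; last first.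
    by rewrite -[3]/(1 + 2) mulnDl mul1n leq_add2l leq_mul2l leq_imset_card.
  move=> A /imsetP[h _ ->]; split; first exact: joined1.
  by apply/set0Pn; exists h; rewrite inE.
elim: n P => // n IH P Pn hP HP card.
case: (boolP [exists x, exists y, exists A in P, exists B in P,
  [&& x \notin cover P, y \notin cover P, A != B, (x == y) || e x y, touches e x A & touches e y B]]);
  last first.
  move=> nex; exists P; split=> //; first by lia.
  move=> x y A B xC yC AP BP xy tx ty; apply/eqP; apply: contraNT nex => nAB.
  apply/existsP; exists x; apply/existsP; exists y; apply/exists_inP; exists A => //.
  by apply/exists_inP; exists B; rewrite // xC yC nAB xy tx ty.
case/existsP=> x /existsP[y /exists_inP[A AP /exists_inP[B BP]]].
case/and5P=> xC yC nAB xy /andP[/exists_inP[a aA exa] /exists_inP[b bB eyb]].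
(* Merging adds at most the two vertices x and y, possibly equal, and lowers the number of clusters
   by at least one, so the potential does not grow. *)
pose M := (A :|: [set x]) :|: ([set y] :|: B).
have [jA A0] := hP A AP; have [jB _] := hP B BP.
have jAx : joined e (A :|: [set x]).
  by apply: (joinedU se jA (@joined1 _ e x) aA (set11 x)); rewrite se.
have jyB : joined e ([set y] :|: B) by apply: (joinedU se (@joined1 _ e y) jB (set11 y) bB eyb).
have jM : joined e M.
  case: (x =P y) xy => [xey _|_ exy]; last first.
    by apply: (joinedU se jAx jyB _ _ exy); rewrite !inE eqxx ?orbT.
  have -> : M = (A :|: [set x]) :|: B.
    by apply/setP=> z; rewrite !inE xey; case: (z \in A); case: (z == y).
  by apply: (@joinedU _ e _ _ x b se jAx jB _ bB); rewrite ?[in e _ _]xey // !inE eqxx orbT.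
pose P' := M |: (P :\ A :\ B).
have cP' : #|P'| < #|P|.
  have BPA : B \in P :\ A by rewrite !inE eq_sym nAB.
  rewrite (cardsD1 A P) AP (cardsD1 B) BPA /P' cardsU1.
  by case: (_ \notin _).
have subM : M \subset cover P'.
  by apply: (bigcup_max M) => //; rewrite !inE eqxx.
have cov : cover P \subset cover P'.
  apply/subsetP=> z /bigcupP[D DP zD].
  case: (D =P A) => [DA|/eqP nDA]; first by apply: (subsetP subM); rewrite !inE -DA zD.
  case: (D =P B) => [DB|/eqP nDB]; first by apply: (subsetP subM); rewrite !inE -DB zD !orbT.
  by apply/bigcupP; exists D; rewrite // !inE nDA nDB DP orbT.
have cov' : cover P' \subset cover P :|: [set x; y].
  apply/subsetP=> z /bigcupP[D]; rewrite inE => /orP[/set1P->|]; last first.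
    by rewrite !inE => /and3P[_ _ DP] zD; apply/orP; left; apply/bigcupP; exists D.
  have inC E : E \in P -> z \in E -> z \in cover P by move=> EP zE; apply/bigcupP; exists E.
  rewrite !inE => /orP[/orP[/(inC _ AP)->|->]|/orP[->|/(inC _ BP)->]] //; by rewrite !orbT.
have cc : #|cover P'| <= #|cover P| + 2.
  apply: leq_trans (subset_leq_card cov') _; rewrite cardsU cards2.
  by apply: leq_trans (leq_subr _ _) _; rewrite leq_add2l; case: (x != y).
apply: (IH P'); [exact: leq_trans cP' Pn | | exact: subset_trans HP cov | ]; last first.
  apply: leq_trans card; apply: leq_trans (leq_add cc (leqnn _)) _.
  by rewrite -addnA leq_add2l -{1}(muln1 2) -mulnDr leq_mul2l add1n.
move=> D; rewrite !inE => /orP[/eqP->|/and3P[_ _ /hP//]]; split=> //.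
by apply/set0Pn; exists a; rewrite !inE aA.
Qed.

(** A K4 minor among the vertices dominated by one cluster would give a K5 minor with the cluster as
    apex. By the separation hypothesis adjacent vertices belong to the same cluster, so the separate
    3-colourings fit together. *)
Lemma cluster_colouring e (P : {set {set T}}) : symmetric e -> irreflexive e ->
  ~ Kminor 5 e [set: T] ->
  (forall A, A \in P -> joined e A /\ A != set0) ->
  (forall x y A B, x \notin cover P -> y \notin cover P -> A \in P -> B \in P ->
         (x == y) || e x y -> touches e x A -> touches e y B -> A = B) ->
  exists c, proper e [set x | (x \notin cover P) && [exists A in P, touches e x A]] 3 c.
Proof.
move=> se ie noK hP sep.
pose NA A := [set x | (x \notin cover P) && touches e x A].
have colA A : exists c, A \in P -> proper e (NA A) 3 c.
  case: (boolP (A \in P)) => [AP|_]; last by exists (fun _ => 0).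
  have [jA A0] := hP A AP.
  have [|c cp] := no_K4_minor_colouring se ie (S := NA A); last by exists c.
  move=> K4; apply: noK; apply: (@Kminor_sub _ _ _ (NA A :|: A)); first exact: subsetT.
  apply: Kminor_apex => //.
    rewrite disjoint_subset; apply/subsetP=> x; rewrite !inE => /andP[xC _].
    by apply: contra xC => xA; apply/bigcupP; exists A.
  by move=> x; rewrite inE => /andP[_ /exists_inP[a aA exa]]; exists a.
have [col hcol] := fin_all_exists colA.
pose cl x := odflt set0 [pick A in P | touches e x A].
have clP x : [exists A in P, touches e x A] -> cl x \in P /\ touches e x (cl x).
  case/exists_inP=> A AP tA; rewrite /cl; case: pickP => [B /andP[]//|/(_ A)].
  by rewrite AP tA.
exists (fun x => col (cl x) x); split=> [x|x y].
  rewrite inE => /andP[xC /clP[AP tx]]; have [h _] := hcol _ AP; apply: h.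
  by rewrite inE xC.
rewrite !inE => /andP[xC /clP[AP tx]] /andP[yC /clP[BP ty]] exy.
have E : cl x = cl y by apply: (sep x y) => //; rewrite exy orbT.
rewrite -E in ty *; have [_ h] := hcol _ AP; apply: h => //; by rewrite inE ?xC ?yC.
Qed.

End Hubs.

(** * Conflicts at distance at most two *)

Section Conflicts.
Variable T : finType.
Implicit Types (e r : rel T) (S A H X N : {set T}) (f : T -> T).

Definition conflict e : rel T :=
  [rel x y | (x != y) && (e x y || [exists w, e x w && e w y])].

Lemma conflict_sym e : symmetric e -> symmetric (conflict e).
Proof.
move=> se x y; rewrite /conflict /= eq_sym se; congr (_ && (_ || _)).
by apply: eq_existsb => w; rewrite andbC se (se x).
Qed.

Lemma conflict_irr e : irreflexive (conflict e).
Proof. by move=> x; rewrite /conflict /= eqxx. Qed.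

Lemma arcs_le e S : symmetric e -> irreflexive e -> ~ Kminor 5 e S -> arcs e S <= 8 * #|S|.
Proof.
move=> se ie noK; rewrite leqNgt; apply/negP => h; apply: noK.
apply: (@Kminor_of_arcs _ 3) => //; last exact: ltnW.
by apply: contraTneq h => ->; rewrite /arcs big_set0.
Qed.

(* Each contraction creates a new edge on A, so sparsity of the quotient will bound their number. *)
Lemma saturated_contraction e A : symmetric e -> irreflexive e ->
  exists f : T -> T, [/\ forall x, x \in A -> f x = x,
    forall x, f x \in A -> f x = x \/ e x (f x),
    #|[set x | f x != x]| <= arcs (quot f e) A &
    forall w x y, w \notin A -> f w = w -> x \in A -> y \in A -> x != y ->
      e w x -> e w y -> quot f e x y].
Proof.
move=> se ie.
suff gen n f : #|[set x | f x == x]| < n -> (forall x, x \in A -> f x = x) ->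
    (forall x, f x \in A -> f x = x \/ e x (f x)) ->
    #|[set x | f x != x]| <= arcs (quot f e) A ->
    exists f : T -> T, [/\ forall x, x \in A -> f x = x,
    forall x, f x \in A -> f x = x \/ e x (f x),
    #|[set x | f x != x]| <= arcs (quot f e) A &
    forall w x y, w \notin A -> f w = w -> x \in A -> y \in A -> x != y ->
      e w x -> e w y -> quot f e x y].
  apply: (gen _ (fun x => x) (ltnSn _)) => //; first by move=> x _; left.
  suff -> : [set x : T | x != x] = set0 by rewrite cards0.
  by apply/setP=> x; rewrite !inE eqxx.
elim: n f => // n IH f fn fA fe fW.
case: (boolP [exists w, exists x in A, exists y in A,
   [&& w \notin A, f w == w, x != y, e w x, e w y & ~~ quot f e x y]]); last first.
  move=> nex; exists f; split=> // w x y wA fw xA yA xy ewx ewy.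
  apply: contraNT nex => nq; apply/existsP; exists w; apply/exists_inP; exists x => //.
  by apply/exists_inP; exists y; rewrite // wA fw eqxx xy ewx ewy nq.
case/existsP=> w /exists_inP[x xA /exists_inP[y yA]].
case/and5P=> wA /eqP fw nxy ewx /andP[ewy nq].
(* Contracting w into x makes x and y adjacent, and one fixed point of [f] fewer remains. *)
pose f' z := if z == w then x else f z.
have Aw z : z \in A -> z != w by move=> zA; apply: contraNneq wA => <-.
have wx : x != w by apply: Aw.
have f'A z : z \in A -> f' z = z by move=> zA; rewrite /f' (negbTE (Aw z zA)) fA.
have mono u v : u \in A -> v \in A -> quot f e u v -> quot f' e u v.
  move=> uA vA /quotP[nuv [a [b [fa fb eab]]]]; apply/quotP; split=> //; exists a, b.
  have nw z t : t \in A -> f z = t -> f' z = t.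
    by move=> tA; rewrite /f'; case: eqP => // -> E; rewrite -E fw in tA; rewrite tA in wA.
  by split=> //; apply: nw.
have q' : quot f' e x y.
  apply/quotP; split; first exact/eqP.
  by exists w, y; rewrite /f' eqxx (negbTE (Aw y yA)) fA.
have W' : [set z | f' z != z] = w |: [set z | f z != z].
  apply/setP=> z; rewrite !inE /f'; case: (z =P w) => [->|_] //=.
have cW : #|[set z | f' z != z]| <= #|[set z | f z != z]|.+1.
  by rewrite W' cardsU1 !inE; case: (~~ _).
have cF : #|[set z | f' z == z]| < #|[set z | f z == z]|.
  apply: proper_card; apply/properP; split.
    apply/subsetP=> z; rewrite !inE /f'; case: (z =P w) => [->|//].
    by rewrite (negbTE wx).
  by exists w; rewrite !inE ?fw // /f' eqxx.
apply: (IH f') => //.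
- by lia.
- move=> z; rewrite /f'; case: eqP => [->|_]; last exact: fe.
  by move=> _; right.
apply: leq_trans cW (leq_ltn_trans fW _).
rewrite /arcs (big_setD1 x) //= [in X in _ < X](big_setD1 x) //= -addSn.
apply: leq_add.
  apply: proper_card; apply/properP; split.
    by apply/subsetP=> z; rewrite !inE => /andP[zA h]; rewrite zA mono.
  by exists y; rewrite !inE yA ?q' // (negbTE nq).
apply: leq_sum => z; rewrite !inE => /andP[_ zA]; apply: subset_leq_card.
by apply/subsetP=> v; rewrite !inE => /andP[vA h]; rewrite vA mono.
Qed.

Lemma card_bigcup_le (I : finType) (Q : pred I) (F : I -> {set T}) :
  #|\bigcup_(i | Q i) F i| <= \sum_(i | Q i) #|F i|.
Proof.
elim/big_ind2: _ => [|A a B b hA hB|//]; first by rewrite cards0.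
by rewrite cardsU; apply: leq_trans (leq_subr _ _) (leq_add hA hB).
Qed.

Lemma nbr_sub e S S' x : S \subset S' -> #|nbr e S x| <= #|nbr e S' x|.
Proof.
move=> /subsetP sS; apply: subset_leq_card; apply/subsetP=> y.
by rewrite !inE => /andP[/sS-> ->].
Qed.

(* Only the few vertices of R = A + W matter, and among these k^2 <= d (k - 8) + 8 k, where the sum
   of k - 8 over B (the vertices with k > 8) is at most 8 |A| because A + B spans a sparse graph. *)
Lemma few_conflicts e A d : symmetric e -> irreflexive e -> ~ Kminor 5 e [set: T] ->
  (forall w, #|nbr e A w| <= d) -> A != set0 ->
  exists2 x, x \in A & #|nbr (conflict e) A x| < 8 * d + 585.
Proof.
move=> se ie noK hd A0.
have sparse S : arcs e S <= 8 * #|S|.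
  by apply: arcs_le => // h; apply: noK; apply: Kminor_sub h; apply: subsetT.
have [f [fA fe fW sat]] := saturated_contraction A se ie.
pose M := quot f e; pose W := [set x | f x != x]; pose R := A :|: W.
pose k w := #|nbr e A w|.
have M8 : arcs M A <= 8 * #|A|.
  apply: arcs_le; [exact: quot_sym | exact: quot_irr | move=> h; apply: noK].
  by apply: (Kminor_quot se fA _ h) => a fa; split; rewrite ?inE //; apply: fe.
have R9 : #|R| <= 9 * #|A|.
  have : #|R| <= #|A| + #|W| by rewrite cardsU leq_subr.
  by have : #|W| <= 8 * #|A| := leq_trans fW M8; lia.
(* Conflicts by an edge, or through an unmoved middle vertex outside [A], are edges of [M] by
   saturation; those through [w] in [R] number at most [k w]. *)
have bound x : x \in A -> #|nbr (conflict e) A x| <= #|nbr M A x| + \sum_(w in R | e x w) k w.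
  move=> xA; apply: leq_trans (_ : #|nbr M A x :|: \bigcup_(w in R | e x w) nbr e A w| <= _).
    apply: subset_leq_card; apply/subsetP=> y; rewrite !inE => /and3P[yA nxy].
    case/orP=> [exy|/existsP[w /andP[exw ewy]]].
      by rewrite yA; apply/orP; left; apply/quotP; split; [exact/eqP | exists x, y; rewrite !fA].
    case: (boolP (w \in R)) => wR.
      by apply/orP; right; apply/bigcupP; exists w; rewrite ?wR // inE yA.
    move: wR; rewrite !inE negb_or negbK => /andP[wA /eqP fw].
    by rewrite yA; apply/orP; left; apply: (sat w) => //; rewrite se.
  rewrite cardsU; apply: leq_trans (leq_subr _ _) _; rewrite leq_add2l.
  exact: card_bigcup_le.
(* Double counting: each [w] in [R] is met from each of its [k w] neighbours in [A]. *)
have swap : \sum_(x in A) \sum_(w in R | e x w) k w = \sum_(w in R) k w * k w.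
  rewrite (exchange_big_dep (mem R)) /=; last by move=> ? ? _ /andP[].
  apply: eq_bigr => w wR; rewrite sum_nat_cond_const; congr (_ * _).
  by apply: eq_card => x; move: wR; rewrite !inE => ->; rewrite se.
pose B := [set w in R | 8 < k w].
have kB : \sum_(w in R) (k w - 8) <= 8 * #|A|.
  have eB : \sum_(w in R) (k w - 8) = \sum_(w in B) (k w - 8).
    rewrite (bigID (fun w => 8 < k w)) /= [X in _ + X]big1 ?addn0; last first.
      by move=> w /andP[_]; lia.
    by apply: eq_bigl => w; rewrite !inE.
  have e8 : \sum_(w in B) (k w - 8) + 8 * #|B| = \sum_(w in B) k w.
    rewrite mulnC -sum_nat_const -big_split /=; apply: eq_bigr => w.
    by rewrite inE => /andP[_]; lia.
  have : \sum_(w in B) k w <= 8 * #|B :|: A|.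
    apply: leq_trans (sparse _); rewrite /arcs.
    apply: leq_trans (_ : \sum_(w in B) #|nbr e (B :|: A) w| <= _).
      by apply: leq_sum => w _; apply: nbr_sub; apply: subsetUr.
    by rewrite [in X in _ <= X](big_setID B) /= setUK leq_addr.
  have : #|B :|: A| <= #|B| + #|A| by rewrite cardsU leq_subr.
  by lia.
have kR : \sum_(w in R) k w <= 72 * #|A|.
  apply: leq_trans (_ : arcs e R <= _); last by have := sparse R; lia.
  by apply: leq_sum => w _; apply: nbr_sub; apply: subsetUl.
have sq : \sum_(w in R) k w * k w <= d * \sum_(w in R) (k w - 8) + 8 * \sum_(w in R) k w.
  rewrite !big_distrr /= -big_split /=; apply: leq_sum => w _.
  by have := hd w; rewrite -/(k w) => ?; case: (leqP 8 (k w)) => ?; nia.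
apply: sum_lt_ex.
have A1 : 0 < #|A| by rewrite card_gt0.
(* The total is at most 8 |A| for [M], plus 8 d |A|, plus 8 * 72 |A|, which is (8 d + 584) |A|. *)
apply: leq_ltn_trans (leq_sum _ bound) _; rewrite big_split /= swap -/(arcs M A).
by nia.
Qed.

Lemma no_K5_minor_ab_colorable e d b : symmetric e -> irreflexive e ->
  ~ Kminor 5 e [set: T] -> 0 < d -> 3 * (#|T| %/ d) + 8 * d + 585 <= b ->
  ab_colorable e 3 b.
Proof.
move=> se ie noK d0 hb.
have [H Hd hH] := hubs_exist se d0.
have [P [hP HP cP sep]] := clusters_exist H se.
have [c3 [c3q c3p]] := cluster_colouring se ie noK hP sep.
set X := remote e H in hH; set C := cover P in HP cP c3q c3p.
have [|cX [cXq cXp]] := @degenerate_colouring _ (conflict e) X (8 * d + 585)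
   (conflict_sym se) (@conflict_irr e).
  move=> A AX A0; apply: few_conflicts => // w.
  by apply: ltnW; apply: leq_ltn_trans (hH w); apply: nbr_sub.
have hC : #|C| <= 3 * (#|T| %/ d).
  by apply: leq_trans cP _; rewrite leq_mul2l leq_divRL.
(* Colours 0 to 2 are for [c3], then each vertex of [C] has a colour of its own, then come the
   colours of [X]. Merging may have put vertices of [X] into [C], so [C] is tested first. *)
pose val v := if v \in C then 3 + index v (enum C)
  else if v \in X then 3 + #|C| + cX v else c3 v.
set N := [set x | _] in c3q c3p.
(* A vertex outside [C] and [X] is adjacent to a hub, and every hub lies in a cluster. *)
have inN v : v \notin C -> v \notin X -> v \in N.
  move=> vC; rewrite !inE vC negb_and !negbK => /orP[/(subsetP HP)|]; first by rewrite (negbTE vC).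
  case/exists_inP=> h hH' evh; have /bigcupP[A AP hA] := subsetP HP _ hH'.
  by apply/exists_inP; exists A => //; apply/exists_inP; exists h.
have idx v : v \in C -> index v (enum C) < #|C| by move=> vC; rewrite cardE index_mem mem_enum.
have vlt v : val v < 3 + b.
  rewrite /val; case: ifP => vC; first by have := idx v vC; lia.
  case: ifP => vX; first by have := cXq v vX; lia.
  by have := c3q v (inN v (negbT vC) (negbT vX)); lia.
exists (fun v => Ordinal (vlt v)); split=> i hi.
  have low v : Ordinal (vlt v) == i -> v \in N /\ c3 v = i.
    move/eqP=> /(congr1 (@nat_of_ord _)) /=; rewrite /val.
    case: ifP => vC; first by lia.
    case: ifP => vX; first by lia.
    by split=> //; apply: inN; rewrite ?vC ?vX.
  move=> x y /low[xN cx] /low[yN cy]; apply/negP => exy.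
  by have := c3p x y xN yN exy; rewrite cx cy eqxx.
move=> x y /eqP/(congr1 (@nat_of_ord _)) /= vx /eqP/(congr1 (@nat_of_ord _)) /= vy nxy.
have vxy : val x = val y by rewrite vx vy.
suff nc : ~~ conflict e x y.
  move: nc; rewrite /conflict /=; case: eqP => //= _; rewrite negb_or => /andP[-> ].
  by rewrite negb_exists => /forallP.
have high v : val v = i -> v \in C \/ v \in X.
  rewrite /val; case: ifP => vC; first by left.
  case: ifP => vX; first by right.
  by have := c3q v (inN v (negbT vC) (negbT vX)); lia.
move: vxy; rewrite /val; case: (boolP (x \in C)) => xC; case: (boolP (y \in C)) => yC.
- move/addnI/(congr1 (nth x (enum C))); rewrite !nth_index ?mem_enum //.
- by case: ifP => yX; [have := idx x xC; lia | case: (high y vy) => h; rewrite h in yC yX].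
- by case: ifP => xX; [have := idx y yC; lia | case: (high x vx) => h; rewrite h in xC xX].
have xX : x \in X by case: (high x vx) => // h; rewrite h in xC.
have yX : y \in X by case: (high y vy) => // h; rewrite h in yC.
rewrite xX yX => /addnI E; apply/negP => cxy.
by have := cXp x y xX yX cxy; rewrite E eqxx.
Qed.

End Conflicts.

(** * The error term and the choice of d *)

Local Open Scope R_scope.

Lemma sqrt_INR_gt0 n : (0 < n)%nat -> 0 < sqrt (INR n).
Proof. by move=> n0; apply/sqrt_lt_R0/lt_0_INR; lia. Qed.

Lemma Un_cv_const_div_sqrt c : 0 < c -> Un_cv (fun n => c / sqrt (INR n)) 0.
Proof.
move=> c0 eps e0.
have [N [cN N0]] := archimed_cor1 (eps * eps / (c * c)) ltac:(apply: Rdiv_lt_0_compat; nra).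
exists N.+1 => n nN; rewrite /Rdist Rminus_0_r.
have n0 : (0 < n)%nat by lia.
have s0 := sqrt_INR_gt0 n0.
rewrite Rabs_pos_eq; last by left; apply: Rdiv_lt_0_compat.
apply: (Rmult_lt_reg_r (sqrt (INR n))) => //.
have -> : c / sqrt (INR n) * sqrt (INR n) = c by field; lra.
have Nn : INR N < INR n by apply: lt_INR; lia.
have Np : 0 < INR N by apply: lt_0_INR.
have ss := sqrt_sqrt (INR n) (pos_INR n).
suff h : c * c < eps * eps * INR n.
  apply: Rnot_le_lt => le.
  have := Rmult_le_compat _ _ _ _ (Rmult_le_pos _ _ (Rlt_le _ _ e0) (Rlt_le _ _ s0))
    (Rmult_le_pos _ _ (Rlt_le _ _ e0) (Rlt_le _ _ s0)) le le.
  have -> : eps * sqrt (INR n) * (eps * sqrt (INR n)) = eps * eps * (sqrt (INR n) * sqrt (INR n)) by ring.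
  by rewrite ss; lra.
have : c * c < eps * eps * INR N.
  move: cN => /(Rmult_lt_compat_r (INR N * (c * c)) _ _ (Rmult_lt_0_compat _ _ Np (Rmult_lt_0_compat _ _ c0 c0))).
  have -> : / INR N * (INR N * (c * c)) = c * c by field; lra.
  by have -> : eps * eps / (c * c) * (INR N * (c * c)) = eps * eps * INR N by field; lra.
nra.
Qed.

(* d is about (3/5) sqrt n, so that 3 (n / d) + 8 d <= 9.8 sqrt n + 8, while 6 sqrt 3 > 10.2; the
   term 100 / sqrt n contributes more than 1000 and absorbs the additive constant. *)
Lemma threshold_exists n b : (0 < n)%nat ->
  6 * sqrt 3 * (1 + 100 / sqrt (INR n)) * sqrt (INR n) <= INR b ->
  exists2 d, (0 < d)%nat & (3 * (n %/ d) + 8 * d + 585 <= b)%nat.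
Proof.
move=> n0 hb; have s0 := sqrt_INR_gt0 n0.
have ss := sqrt_sqrt (INR n) (pos_INR n).
move: hb; set s := sqrt (INR n) in s0 ss * => hb.
have r3 : 17 / 10 <= sqrt 3.
  by rewrite -(sqrt_square (17 / 10)); [apply: sqrt_le_1; lra | lra].
(* These are 6 * 1.7 and 600 * 1.7. *)
have hb' : (51 / 5) * s + 1020 <= INR b.
  have E : 6 * sqrt 3 * (1 + 100 / s) * s = 6 * sqrt 3 * s + 600 * sqrt 3 by field; lra.
  rewrite E in hb; nra.
have [up1 up2] := archimed (3 / 5 * s).
have z0 : (0 <= up (3 / 5 * s))%Z by apply: le_IZR; lra.
have [d dz] := IZN _ z0.
have dE : INR d = IZR (up (3 / 5 * s)) by rewrite INR_IZR_INZ dz.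
have d0 : (0 < d)%nat.
  by case: (posnP d) => // E; move: dE; rewrite E /=; nra.
exists d => //; apply/leP/INR_le.
have mE a c : INR (a * c)%nat = INR a * INR c by exact: mult_INR.
have pE a c : INR (a + c)%nat = INR a + INR c by exact: plus_INR.
rewrite pE pE mE mE.
have : INR (n %/ d) * INR d <= INR n.
  by rewrite -mE; apply/le_INR/leP; apply: leq_trunc_div.
have -> : INR 585 = 585 by rewrite INR_IZR_INZ.
have -> : INR 3 = 3 by rewrite INR_IZR_INZ.
have -> : INR 8 = 8 by rewrite INR_IZR_INZ.
have := pos_INR (n %/ d); set k := INR (n %/ d) => k0 kd.
have : k * (3 / 5 * s) <= s * s by nra.
move=> ks; have : k <= 5 / 3 * s by nra.
by lra.
Qed.

Theorem mainTheorem20 :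
  exists eps : nat -> R, Un_cv eps 0 /\
    forall (T : finType) (e : rel T), simple_graph e -> planar e ->
      forall b : nat,
        6 * sqrt 3 * (1 + eps #|T|%N) * sqrt (INR #|T|%N) <= INR b ->
        ab_colorable e 3 b.
Proof.
exists (fun n => 100 / sqrt (INR n)); split; first by apply: Un_cv_const_div_sqrt; lra.
move=> T e [se ie] pl b hb.
(* The choice of d needs a positive order; the empty graph is coloured by the empty function. *)
have [T0|T0] := posnP #|T|.
  have no (x : T) : False by have := fintype0 x T0.
  by exists (fun x => match no x with end); split=> i _ x; case: (no x).
have [d d0 hd] := threshold_exists T0 hb.
apply: (no_K5_minor_ab_colorable se ie _ d0 hd).
exact: planar_no_K5_minor.
Qed.
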